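(* Let $n>2$ be an integer. The Lie algebra $\mathfrak{sl}(n,\mathbb{R})$ does not admit an overalgebra almost separating of degree $2$.
   Context: Let $G=SL(n,\mathbb{R})$, $\mathfrak g=\mathfrak{sl}(n,\mathbb{R})$; $\mathfrak g^\star$ is identified with $\mathfrak g$ by the invariant form $\langle X,Y\rangle=\mathrm{Tr}(XY)$, so that the coadjoint action $\mathrm{Coad}$ becomes conjugation. An element $\xi\in\mathfrak g^\star=\mathfrak{sl}(n,\mathbb{R})$ is called generic if it belongs to $\Omega=\{\xi\in\mathfrak{sl}(n,\mathbb{R}) : \xi \text{ has } n \text{ distinct complex eigenvalues}\}$. Given a finite-dimensional real linear representation $(\pi,V)$ of $G$, let $G^+=G\rtimes V$ be the Lie group with underlying set $G\times V$ and law $(g,v)(g',v')=(gg',v+\pi(g)v')$. Its Lie algebra is $\mathfrak g^+=\mathfrak g\rtimes V$, with bracket $[(X,u),(X',u')]=([X,X'],\pi'(X)u'-\pi'(X')u)$, where $\pi'$ is the derivative of $\pi$. One identifies $(\mathfrak g^+)^\star$ with $\mathfrak g^\star\oplus V^\star$. Let $p:(\mathfrak g^+)^\star\to\mathfrak g^\star$ be the canonical projection. An overalgebra almost separating of degree $d$ of $\mathfrak g$ is a pair $(\mathfrak g^+,\phi)$ where $\mathfrak g^+=\mathfrak g\rtimes V$ is the Lie algebra, with bracket $[(X,u),(X',u')]=([X,X'],\pi'(X)u'-\pi'(X')u)$, of the Lie group $G^+=G\rtimes V$ associated with some finite-dimensional real linear representation $(\pi,V)$ of $G$, and $\phi:\mathfrak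 g^\star\to V^\star$ is a polynomial map of degree $d$, such that the map $\Phi:\mathfrak g^\star\to(\mathfrak g^+)^\star$, $\Phi(\xi)=(\xi,\phi(\xi))$ (so $p\circ\Phi=\mathrm{id}$) satisfies: (i) $\Phi(\mathrm{Coad}(G)\xi)=\mathrm{Coad}(G^+)\Phi(\xi)$ for every $\xi\in\mathfrak g^\star$; (ii) for every generic $\xi$, the set of coadjoint orbits $\mathrm{Coad}(G)\xi'$, $\xi'\in\mathfrak g^\star$, such that $\overline{\mathrm{Conv}}\big(\Phi(\mathrm{Coad}(G)\xi')\big)=\overline{\mathrm{Conv}}\big(\Phi(\mathrm{Coad}(G)\xi)\big)$ is finite. Here $\overline{\mathrm{Conv}}$ denotes the closed convex hull. *)

(* Defs.v *)
From mathcomp Require Import all_boot all_order all_algebra.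
From mathcomp Require Import complex.
From mathcomp Require Import all_classical all_reals all_analysis.
(* The notations of mpoly clash with those of mathcomp-analysis. *)
From mathcomp Require Import (canonicals, coercions) mpoly.

Set Implicit Arguments.
Unset Strict Implicit.
Unset Printing Implicit Defensive.

Import Order.TTheory GRing.Theory Num.Theory numFieldNormedType.Exports.

Local Open Scope classical_set_scope.
Local Open Scope ring_scope.

Section SpecialLinear.
Context {R : realType} {n : nat}.

Definition SL : set 'M[R]_n := [set g | \det g = 1].

(* The Lie algebra sl(n, R), and also its dual, through the form Tr(XY). *)
Definition sl : set 'M[R]_n := [set X | \tr X = 0].

Definition coad_orbit (xi : 'M[R]_n) : set 'M[R]_n :=
  [set g *m xi *m invmx g | g in SL].

Definition generic (xi : 'M[R]_n) : Prop :=
  sl xi /\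
  exists s : seq (complex R), [/\ uniq s, size s = n &
    forall z, z \in s -> eigenvalue (map_mx (real_complex R) xi) z].

End SpecialLinear.

Section ClosedConvexHull.
Context {R : realType} {E : normedModType R}.

Definition closed_convex_hull (A : set E) : set E :=
  closure (smallest (@convex_set R E) A : set E).

End ClosedConvexHull.

Section SemidirectProduct.
Context {R : realType} {n m : nat}.

(* A Lie group representation of SL(n, R) on V = R^m, acting on columns.  Since
   SL(n, R) is a submanifold of 'M_n, differentiability is expressed by means
   of an extension of the representation to 'M_n (for example g |->
   pi ((\det g)^(-1/n) g) near SL(n, R)).  The values of pi outside SL(n, R)
   are otherwise irrelevant: only derivatives of pi along directions tangent to
   SL(n, R) are used below.  A continuous finite-dimensional representation is
   automatically smooth, hence is of this kind. *)
Definition representation (pi : 'M[R]_n -> 'M[R]_m) : Prop :=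
  [/\ pi 1%:M = 1%:M,
      forall g h, SL g -> SL h -> pi (g *m h) = pi g *m pi h &
      forall g, SL g -> differentiable pi g].

Variable pi : 'M[R]_n -> 'M[R]_m.

(* The Lie group G^+ = SL(n, R) |x V, its Lie algebra g^+ = sl(n, R) |x V, and
   the dual of g^+, which is identified with sl(n, R) (+) V^*, where V^* is the
   space of row vectors. *)
Definition Gplus : set ('M[R]_n * 'cV[R]_m) := [set h | SL h.1].
Definition gplus : set ('M[R]_n * 'cV[R]_m) := [set Y | sl Y.1].
Definition gplus_dual : set ('M[R]_n * 'rV[R]_m) := [set l | sl l.1].

Definition mulG (h k : 'M[R]_n * 'cV[R]_m) : 'M[R]_n * 'cV[R]_m :=
  (h.1 *m k.1, h.2 + pi h.1 *m k.2).

Definition invG (h : 'M[R]_n * 'cV[R]_m) : 'M[R]_n * 'cV[R]_m :=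
  (invmx h.1, - (pi (invmx h.1) *m h.2)).

(* Ad h is the differential at the identity of k |-> h k h^-1. Explicitly,
     Ad (g, v) (X, u) = (g X g^-1, pi g u - pi' (g X g^-1) v),
   where pi' = 'd pi 1; the differential of Ad at the identity is the bracket
     [(X, u), (X', u')] = ([X, X'], pi' X u' - pi' X' u). *)
Definition Ad (h : 'M[R]_n * 'cV[R]_m) :
    'M[R]_n * 'cV[R]_m -> 'M[R]_n * 'cV[R]_m :=
  'd (fun k : 'M[R]_n * 'cV[R]_m => mulG (mulG h k) (invG h))
     ((1%:M, 0) : 'M[R]_n * 'cV[R]_m).

Definition pairing (l : 'M[R]_n * 'rV[R]_m) (Y : 'M[R]_n * 'cV[R]_m) : R :=
  \tr (l.1 *m Y.1) + (l.2 *m Y.2) 0 0.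

(* <Coad h l, Y> = <l, Ad h^-1 Y> *)
Definition coad_plus_orbit (l : 'M[R]_n * 'rV[R]_m) :
    set ('M[R]_n * 'rV[R]_m) :=
  [set l' | gplus_dual l' /\ exists2 h, Gplus h &
    forall Y, gplus Y -> pairing l' Y = pairing l (Ad (invG h) Y)].

End SemidirectProduct.

Section Overalgebra.
Context {R : realType} {n m : nat}.
Implicit Type phi : 'M[R]_n -> 'rV[R]_m.

(* Polynomial functions on sl(n, R) are the restrictions of polynomials in the
   n * n matrix entries; msize is one more than the total degree. *)
Definition polynomial_map_le (d : nat) phi : Prop :=
  exists2 p : 'I_m -> mpoly.mpoly (n * n) R,
    forall j, (mpoly.msize (p j) <= d.+1)%N &
    forall xi, sl xi -> forall j,
      phi xi 0 j = mpoly.meval (fun k => mxvec xi 0 k) (p j).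

Definition polynomial_map_of_degree (d : nat) phi : Prop :=
  polynomial_map_le d phi /\
  forall e, polynomial_map_le e phi -> (d <= e)%N.

Definition overalgebra_almost_separating (d : nat)
    (pi : 'M[R]_n -> 'M[R]_m) (phi : 'M[R]_n -> 'rV[R]_m) : Prop :=
  let Phi xi := (xi, phi xi) in
  [/\ representation pi,
      polynomial_map_of_degree d phi,
      forall xi, sl xi ->
        Phi @` coad_orbit xi = coad_plus_orbit pi (Phi xi) &
      forall xi, generic xi ->
        finite_set [set O | exists2 xi', sl xi' & O = coad_orbit xi' /\
          closed_convex_hull (Phi @` coad_orbit xi') =
          closed_convex_hull (Phi @` coad_orbit xi)]].

End Overalgebra.

(* Main.v *)
Require Import Defs.
From HB Require Import structures.
From mathcomp Require Import all_boot all_order all_algebra.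
From mathcomp Require Import all_classical all_reals all_analysis.
From mathcomp Require Import complex.
From mathcomp Require Import zify ring lra.
From mathcomp Require Import (canonicals, coercions) mpoly.

Set Implicit Arguments.
Unset Strict Implicit.
Unset Printing Implicit Defensive.

Import Order.TTheory GRing.Theory Num.Theory numFieldNormedType.Exports.

Local Open Scope classical_set_scope.
Local Open Scope ring_scope.

(** The orbit condition on [Phi] says two things.  Elements [(g, 0)] of the big
    group make [phi] equivariant ([phi_equivariant]).  Elements [(1, v)] fix the
    [V^*]-component of [Phi xi] and translate its [sl(n)]-component, so that
    [phi (xi + theta) = phi xi] whenever [theta] represents a linear form
    [X |-> phi xi (pi' X v)] ([phi_translation]).

    For a polynomial map of degree at most 2 this forces [phi] to be constant on
    the orbit of every diagonal matrix with distinct entries.  Let [D] be diagonal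
    with entries [d_i <> d_j], and let [beta] be the derivative of [phi] at [D] in
    the direction [E_ij].
    - If [beta = 0], then [phi] is an even quadratic polynomial on the line
      [D + z E_ij]; but conjugation by the unipotents [1 + r E_ij] acts on this
      line by all translations, and this kills the quadratic coefficient.
    - If [beta <> 0], then the diagonal torus, which fixes [D], separates the
      directions [E_kl] by their weights, so some [theta] as above is exactly
      [E_ji], and [phi] is constant on the line [D + z E_ji].
    Conjugation by [1 + r E_ij] carries a suitable point of [D + z E_ji] to
    [D' + z E_ji], where [D'] is [D] with [d_i] and [d_j] exchanged.  This
    equates a polynomial in [r] with a polynomial in [1 / r] if [phi] is constant
    on [D + z E_ji], so that [phi] is constant on [D + z E_ij] as well
    ([constant_on_opposite_line]).  Hence [phi] is always constant on
    [D + z E_ij], and [phi D' = phi D] ([diagonal_rigidity]).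

    When the [d_i] are distinct it follows that all elementary unipotents fix
    [phi D].  They generate [SL(n)] ([SL_transvection_ind]), so [phi] is constant
    on the orbit of [D] ([constant_on_orbit]).  As [phi D] is also symmetric in
    the [d_i] and of degree at most 2, it depends only on the sum of the
    [d_i ^ 2] as long as only three of the [d_i] vary with constant sum
    ([value_on_conic]).

    The convex hull of the orbit of [D] is all of [sl(n)], because the orbit
    contains full lines in enough directions ([midpoint_hull_orbit]).  Hence all
    diagonal matrices with distinct entries and the same value of [phi] have the
    same closed convex hull.  As [n > 2], a rational parametrization of the conic
    [x ^ 2 + x y + y ^ 2 = 1] gives infinitely many such matrices with pairwise
    distinct spectra, and this contradicts the finiteness condition. *)

(** * The adjoint representation of the semidirect product *)

Section AdjointRepresentation.
Context {R : realType}.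

Lemma mx_linear_continuous (p q : nat) (W : normedModType R)
  (f : {linear 'M[R]_(p, q) -> W}) : continuous f.
Proof.
apply: bounded_linear_continuous; apply/linear_boundedP.
near=> r => x; rewrite {1}(matrix_sum_delta x) linear_sum/=.
pose C := \sum_i \sum_j `|f (delta_mx i j)|.
have Cr : C <= r by near: r; apply: nbhs_pinfty_ge; rewrite num_real.
apply: (@le_trans _ _ (C * `|x|)); last by rewrite ler_wpM2r.
rewrite /C mulr_suml (le_trans (ler_norm_sum _ _ _))//; apply: ler_sum => i _.
rewrite linear_sum/= mulr_suml (le_trans (ler_norm_sum _ _ _))//.
apply: ler_sum => j _; rewrite linearZ/= normrZ mulrC ler_wpM2l//.
rewrite [leRHS]/Num.Def.normr/= mx_normrE.
exact: (le_bigmax _ (fun ij : 'I_p * 'I_q => `|x ij.1 ij.2|) (i, j)).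
Unshelve. all: by end_near. Qed.

(** The map [k |-> h k h^-1] is built from linear maps and one occurrence of
    [pi], in the term [pi (g k.1)] that comes from multiplying by [h^-1]; only
    this term contributes a differential of [pi]. *)
Lemma Ad_formula (n m : nat) (pi : 'M[R]_n -> 'M[R]_m)
  (h Y : 'M[R]_n * 'cV[R]_m) :
  representation pi -> SL h.1 ->
  Ad pi h Y = (h.1 *m Y.1 *m invmx h.1,
    pi h.1 *m Y.2 - 'd pi (h.1) (h.1 *m Y.1) *m pi (invmx h.1) *m h.2).
Proof.
case=> _ _ dpi; case: h => g w /= gSL; rewrite /Ad /mulG /invG /=.
have dg := dpi _ gSL.
have lin_diff (V V' : normedModType R) (f : {linear V -> V'}) x :
    continuous f -> is_diff x f f.
  by move=> cf; apply: DiffDef; [exact: linear_differentiable|exact: diff_lin].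
pose p1 : {linear _ -> _} := @fst 'M[R]_n 'cV[R]_m.
pose p2 : {linear _ -> _} := @snd 'M[R]_n 'cV[R]_m.
have c1 : continuous p1 by move=> x; exact: cvg_fst.
have c2 : continuous p2 by move=> x; exact: cvg_snd.
pose x0 : 'M[R]_n * 'cV[R]_m := (1%:M, 0).
pose conj_g : {linear 'M[R]_n -> 'M[R]_n} := mulmxr (invmx g) \o mulmx g.
pose act_g : {linear 'cV[R]_m -> 'cV[R]_m} := mulmx (pi g).
pose left_g : {linear 'M[R]_n -> 'M[R]_n} := mulmx g.
pose on_w : {linear 'M[R]_m -> 'cV[R]_m} := mulmxr (- (pi (invmx g) *m w)).
have diff_conj : is_diff x0 (conj_g \o p1) (conj_g \o p1).
  have := lin_diff _ _ p1 x0 c1 => ?.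
  have := lin_diff _ _ conj_g (p1 x0) (@mx_linear_continuous _ _ _ _) => ?.
  exact: is_diff_comp.
have diff_act : is_diff x0 (act_g \o p2) (act_g \o p2).
  have := lin_diff _ _ p2 x0 c2 => ?.
  have := lin_diff _ _ act_g (p2 x0) (@mx_linear_continuous _ _ _ _) => ?.
  exact: is_diff_comp.
have diff_left : is_diff x0 (left_g \o p1) (left_g \o p1).
  have := lin_diff _ _ p1 x0 c1 => ?.
  have := lin_diff _ _ left_g (p1 x0) (@mx_linear_continuous _ _ _ _) => ?.
  exact: is_diff_comp.
have diff_pi : is_diff x0 (pi \o (left_g \o p1)) ('d pi g \o (left_g \o p1)).
  have e : (left_g \o p1) x0 = g by rewrite /= mulmx1.
  have : is_diff ((left_g \o p1) x0) pi ('d pi g).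
    by rewrite e; exact: DiffDef.
  by move=> ?; exact: is_diff_comp.
have diff_w : is_diff x0 (on_w \o (pi \o (left_g \o p1)))
    (on_w \o ('d pi g \o (left_g \o p1))).
  have := lin_diff _ _ on_w ((pi \o (left_g \o p1)) x0)
    (@mx_linear_continuous _ _ _ _) => ?.
  exact: is_diff_comp.
pose snd_conj := cst w + (act_g \o p2) + (on_w \o (pi \o (left_g \o p1))).
pose dsnd := 0 + (act_g \o p2) + (on_w \o ('d pi g \o (left_g \o p1))).
have diff_cst_act : is_diff x0 (cst w + (act_g \o p2)) (0 + (act_g \o p2)).
  exact: is_diffD.
have diff_snd : is_diff x0 snd_conj dsnd by exact: is_diffD.
have diff_both : is_diff x0 (fun k => ((conj_g \o p1) k, snd_conj k))
    (fun k => ((conj_g \o p1) k, dsnd k)).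
  exact: (is_diff_pair diff_conj diff_snd).
have -> : (fun k : 'M[R]_n * 'cV[R]_m => (g *m k.1 *m invmx g,
      w + pi g *m k.2 + pi (g *m k.1) *m - (pi (invmx g) *m w))) =
    (fun k => ((conj_g \o p1) k, snd_conj k)).
  by apply/funext.
rewrite (@diff_val _ _ _ _ _ _ _ diff_both) /=; congr pair.
by rewrite -[LHS]/(0 + _ + _) /= add0r mulmxN mulmxA.
Qed.

End AdjointRepresentation.

(** * Consequences of the orbit condition *)

Section SpecialLinearClosure.
Context {R : realType} {n : nat}.
Implicit Types g xi X Y : 'M[R]_n.

Lemma SL1 : SL (1%:M : 'M[R]_n).
Proof. exact: det1. Qed.

Lemma SL_unit g : SL g -> g \in unitmx.
Proof. by rewrite unitmxE => ->; exact: unitr1. Qed.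

Lemma SL_inv g : SL g -> SL (invmx g).
Proof. by rewrite /SL /= det_inv => ->; rewrite invr1. Qed.

Lemma SL_mul g h : SL g -> SL h -> SL (g *m h).
Proof. by rewrite /SL /= det_mulmx => -> ->; rewrite mulr1. Qed.

Lemma sl_conj g xi : SL g -> sl xi -> sl (g *m xi *m invmx g).
Proof.
by move=> /SL_unit gu; rewrite /sl /= mxtrace_mulC mulmxA mulVmx// mul1mx.
Qed.

Lemma sl_add X Y : sl X -> sl Y -> sl (X + Y).
Proof. by rewrite /sl /= linearD /= => -> ->; rewrite addr0. Qed.

Lemma sl_scale s X : sl X -> sl (s *: X).
Proof. by rewrite /sl /= linearZ /= => ->; rewrite mulr0. Qed.

Lemma sl_delta i j : i != j -> sl (delta_mx i j : 'M[R]_n).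
Proof.
move=> ij; rewrite /sl /= /mxtrace big1// => k _; rewrite mxE.
by apply/eqP; rewrite pnatr_eq0 eqb0; apply/negP => /andP[/eqP -> ] /(negP ij).
Qed.

Lemma sl_orbit xi X : sl xi -> coad_orbit xi X -> sl X.
Proof. by move=> xisl [g gSL <-]; exact: sl_conj. Qed.

Lemma coad_orbit_refl xi : coad_orbit xi xi.
Proof. by exists 1%:M; [exact: SL1|rewrite invmx1 mulmx1 mul1mx]. Qed.

End SpecialLinearClosure.

Section OrbitCondition.
Context {R : realType} {n m : nat}.
Variables (pi : 'M[R]_n -> 'M[R]_m) (phi : 'M[R]_n -> 'rV[R]_m).
Hypothesis rep : representation pi.
Hypothesis orbit_eq : forall xi, sl xi ->
  (fun xi => (xi, phi xi)) @` coad_orbit xi = coad_plus_orbit pi (xi, phi xi).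

Lemma representationV g : SL g -> pi (invmx g) *m pi g = 1%:M.
Proof.
case: rep => pi1 piM _ gSL; rewrite -piM ?mulVmx ?SL_unit//; exact: SL_inv.
Qed.

Lemma representation_inj g (x y : 'rV[R]_m) :
  SL g -> x *m pi g = y *m pi g -> x = y.
Proof.
move=> gSL /(congr1 (mulmx^~ (pi (invmx g)))); rewrite -!mulmxA.
have -> : pi g *m pi (invmx g) = 1%:M.
  by rewrite -{1}[g]invmxK representationV//; exact: SL_inv.
by rewrite !mulmx1.
Qed.

(** The action of [(g, 0)] is the product of the coadjoint action of [g] and of
    the contragredient of [pi]. *)
Lemma phi_equivariant g xi : SL g -> sl xi ->
  phi (g *m xi *m invmx g) *m pi g = phi xi.
Proof.
move=> gSL xisl.
have : coad_plus_orbit pi (xi, phi xi)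
    (g *m xi *m invmx g, phi xi *m pi (invmx g)).
  split; first exact: sl_conj.
  exists (g, 0) => // Y Ysl.
  rewrite /invG /= Ad_formula //=; last exact: SL_inv.
  rewrite mulmx0 oppr0 mulmx0 subr0 /pairing /= mulmxA invmxK.
  congr (_ + _); last by rewrite mulmxA.
  by rewrite -!mulmxA mxtrace_mulC !mulmxA.
rewrite -orbit_eq// => -[_ _ [-> ->]].
by rewrite -mulmxA representationV ?mulmx1.
Qed.

(** The action of [(1, v)] fixes the second component of [(xi, phi xi)] and
    translates the first one by [theta]; on the graph of [phi] the first
    component determines the second one. *)
Lemma phi_translation xi theta (v : 'cV[R]_m) : sl xi -> sl theta ->
  (forall X, sl X ->
    \tr (theta *m X) = (phi xi *m 'd pi (1%:M : 'M[R]_n) X *m v) 0 0) ->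
  phi (xi + theta) = phi xi.
Proof.
move=> xisl thsl th; have [pi1 _ _] := rep.
have : coad_plus_orbit pi (xi, phi xi) (xi + theta, phi xi).
  split; first exact: sl_add.
  exists (1%:M, v) => [|Y Ysl]; first exact: SL1.
  rewrite /invG /= invmx1 Ad_formula //=; last exact: SL1.
  rewrite invmx1 pi1 !mul1mx !mulmx1.
  rewrite /pairing /= mulmxDl linearD /= th// mulmxDr !mulmxN opprK.
  by rewrite [X in _ = _ + X]mxE -addrA mulmxA; congr (_ + _); rewrite addrC.
by rewrite -orbit_eq// => -[_ _ [-> ->]].
Qed.

End OrbitCondition.

(** * Polynomial maps of degree at most 2 *)

Section LinearFunctions.
Context {R : realType} {V W : lmodType R} (f : V -> W).
Hypothesis f_linear : linear f.

Lemma linear_fun0 : f 0 = 0.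
Proof. by have := f_linear (-1) 0 0; rewrite scaler0 addr0 scaleN1r addNr. Qed.

Lemma linear_funZ s x : f (s *: x) = s *: f x.
Proof. by rewrite -[s *: x]addr0 f_linear linear_fun0 addr0. Qed.

Lemma linear_fun2 s t x y : f (s *: x + t *: y) = s *: f x + t *: f y.
Proof. by rewrite f_linear linear_funZ. Qed.

End LinearFunctions.

Section SecondOrderTaylor.
Context {R : realType}.

(** The exact Taylor formula of a polynomial map of degree at most 2: [d x] is
    its derivative at [x], and [e] is a bilinear map whose quadratic form is the
    homogeneous part of degree 2.  It need not be symmetric: for a product [u v] of
    two linear forms it is [u x * v y]. *)
Definition taylor2 (V W : lmodType R) (A : set V) (f : V -> W)
    (d e : V -> V -> W) :=
  [/\ forall x, linear (d x), forall y, linear (e^~ y), forall x, linear (e x) &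
      forall x y, A x -> A y -> f (x + y) = f x + d x y + e y y].

Section Operations.
Variables (V W : lmodType R) (A : set V).

Lemma taylor2_plane (f : V -> W) d e x y z s t : taylor2 A f d e ->
  A x -> A (s *: y + t *: z) ->
  f (x + (s *: y + t *: z)) = f x + (s *: d x y + t *: d x z) +
    (s ^+ 2 *: e y y + (s * t) *: (e y z + e z y) + t ^+ 2 *: e z z).
Proof.
move=> [dl el er fE] Ax Ayz; rewrite fE// (linear_fun2 (dl x)).
rewrite (linear_fun2 (el _)) !(linear_fun2 (er _)) !scalerDr !scalerA.
by rewrite -!expr2 [t * s]mulrC !addrA.
Qed.

Lemma taylor2_line (f : V -> W) d e x y s : taylor2 A f d e ->
  A x -> A (s *: y) -> f (x + s *: y) = f x + s *: d x y + s ^+ 2 *: e y y.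
Proof.
move=> [dl el er fE] Ax Ay; rewrite fE// (linear_funZ (dl x)).
by rewrite (linear_funZ (el _)) (linear_funZ (er _)) scalerA.
Qed.

Lemma taylor2_cst (c : W) : taylor2 A (fun=> c) (fun _ _ => 0) (fun _ _ => 0).
Proof.
by split=> [x a y z|x a y z|x a y z|x y _ _]; rewrite ?scaler0 ?addr0.
Qed.

Lemma taylor2D (f f' : V -> W) d d' e e' :
  taylor2 A f d e -> taylor2 A f' d' e' ->
  taylor2 A (fun x => f x + f' x) (fun x y => d x y + d' x y)
    (fun x y => e x y + e' x y).
Proof.
move=> [dl el er fE] [dl' el' er' fE'].
split=> [x a y z|x a y z|x a y z|x y Ax Ay].
- by rewrite dl dl' scalerDr addrACA.
- have /= -> := el x a y z; have /= -> := el' x a y z.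
  by rewrite scalerDr addrACA.
- by rewrite er er' scalerDr addrACA.
- by rewrite fE// fE'// addrACA; congr (_ + _); rewrite addrACA.
Qed.

Lemma taylor2Z (f : V -> W) d e (c : R) : taylor2 A f d e ->
  taylor2 A (fun x => c *: f x) (fun x y => c *: d x y) (fun x y => c *: e x y).
Proof.
move=> [dl el er fE]; split=> [x a y z|x a y z|x a y z|x y Ax Ay].
- by rewrite dl scalerDr !scalerA mulrC.
- by have /= -> := el x a y z; rewrite scalerDr !scalerA mulrC.
- by rewrite er scalerDr !scalerA mulrC.
- by rewrite fE// !scalerDr.
Qed.

Lemma taylor2_lin (u : {linear V -> W}) :
  taylor2 A u (fun _ y => u y) (fun _ _ => 0).
Proof.
split=> [x a y z|x a y z|x a y z|x y _ _];
  by rewrite /= ?linearP ?linearD ?scaler0 ?addr0.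
Qed.

Lemma taylor2M (u v : {linear V -> R^o}) :
  taylor2 A (fun x => u x * v x : R^o) (fun x y => u x * v y + u y * v x)
    (fun x y => u x * v y).
Proof.
split=> [x a y z|x a y z|x a y z|x y _ _];
  by rewrite /= ?linearP ?linearD /= ?/GRing.scale /=; ring.
Qed.

End Operations.

Lemma monomial_factor (k : nat) (a : 'I_k -> nat) s : (\sum_i a i = s.+1)%N ->
  exists (i : 'I_k) (b : 'I_k -> nat), (\sum_i b i = s)%N /\
    forall x : 'I_k -> R, \prod_i x i ^+ a i = x i * \prod_i x i ^+ b i.
Proof.
move=> sa; have [i ai] : exists i, (0 < a i)%N.
  apply/existsP; apply: contra_eqT sa; rewrite negb_exists => /forallP a0.
  by rewrite big1// => i _; apply/eqP; have := a0 i; rewrite lt0n negbK.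
exists i, (fun j => a j - (j == i))%N; split.
  move: sa; rewrite (bigD1 i)//= => sa; rewrite (bigD1 i)//= eqxx.
  under eq_bigr => j ji do rewrite (negPf ji) subn0.
  by apply: succn_inj; rewrite -sa -addSn subn1 prednK.
move=> y; rewrite (bigD1 i)//= [in RHS](bigD1 i)//= eqxx mulrA -exprS.
rewrite subn1 prednK//; congr (_ * _).
by apply: eq_bigr => j ji; rewrite (negPf ji) subn0.
Qed.

Lemma taylor2_monomial (V : lmodType R) (A : set V) (k : nat)
    (x : 'I_k -> {linear V -> R^o}) (a : 'I_k -> nat) : (\sum_i a i < 3)%N ->
  exists d e, taylor2 A (fun v => \prod_i x i v ^+ a i : R^o) d e.
Proof.
have one (b : 'I_k -> nat) y :
    (\sum_i b i = 0)%N -> \prod_i y i ^+ b i = 1 :> R.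
  move/eqP; rewrite sum_nat_eq0 => /forallP b0.
  by rewrite big1// => i _; have /= /eqP -> := b0 i.
case E : (\sum_i a i)%N => [|[|[|//]]] _.
- rewrite (_ : (fun v => _) = fun=> 1); last by apply/funext => v; rewrite one.
  by do 2!eexists; exact: taylor2_cst.
- have [i [b [b0 bE]]] := monomial_factor E.
  rewrite (_ : (fun v => _) = x i); first by do 2!eexists; exact: taylor2_lin.
  by apply/funext => v; rewrite bE one ?mulr1.
- have [i [b [b1 bE]]] := monomial_factor E.
  have [j [b' [b'0 b'E]]] := monomial_factor b1.
  rewrite (_ : (fun v => _) = fun v => x i v * x j v).
    by do 2!eexists; exact: taylor2M.
  by apply/funext => v; rewrite bE b'E one ?mulr1.
Qed.

Lemma taylor2_poly (V : lmodType R) (A : set V) (k : nat)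
    (x : 'I_k -> {linear V -> R^o}) (p : mpoly.mpoly k R) :
  (mpoly.msize p <= 3)%N ->
  exists d e, taylor2 A (fun v => mpoly.meval (fun i => x i v) p : R^o) d e.
Proof.
move=> sp; pose X m v : R^o := \prod_(i < k) x i v ^+ m i.
have -> : (fun v => mpoly.meval (fun i => x i v) p : R^o) =
    (fun v => \sum_(m <- mpoly.msupp p) mpoly.mcoeff m p *: X m v).
  by apply/funext => v; rewrite mpoly.mevalE.
have : forall m, m \in mpoly.msupp p -> (\sum_i m i < 3)%N.
  move=> m mp; rewrite -mpoly.mdegE; apply: leq_trans sp.
  exact: mpoly.msize_mdeg_lt.
elim: (mpoly.msupp p : seq _) => [_|m s IH ms].
  rewrite (_ : (fun v => _) = fun=> 0); first by do 2!eexists; exact: taylor2_cst.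
  by apply/funext => v; rewrite big_nil.
have [d' [e' te']] := taylor2_monomial A x (ms m (mem_head _ _)).
have [m' m's|d [e te]] := IH; first by apply: ms; rewrite in_cons m's orbT.
rewrite (_ : (fun v => _) = fun v => mpoly.mcoeff m p *: X m v +
  \sum_(m <- s) mpoly.mcoeff m p *: X m v).
  by do 2!eexists; apply: taylor2D te; exact: taylor2Z te'.
by apply/funext => v; rewrite big_cons.
Qed.

Lemma taylor2_polynomial_map (n m : nat) (phi : 'M[R]_n -> 'rV[R]_m) :
  polynomial_map_le 2 phi ->
  exists d e : 'M[R]_n -> 'M[R]_n -> 'rV[R]_m, taylor2 sl phi d e.
Proof.
case=> p sp phiE.
have coord_linear (k : 'I_(n * n)) :
    linear (fun v : 'M[R]_n => mxvec v 0 k : R^o).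
  by move=> a u v; rewrite linearP !mxE.
pose x (k : 'I_(n * n)) : {linear 'M[R]_n -> R^o} := HB.pack
  (fun v : 'M[R]_n => mxvec v 0 k : R^o)
  (GRing.isLinear.Build R 'M[R]_n R^o *:%R _ (coord_linear k)).
have /choice[d] : forall j, exists d, exists e,
    taylor2 setT (fun v => mpoly.meval (fun i => x i v) (p j) : R^o) d e.
  by move=> j; exact: taylor2_poly.
move=> /choice[e te].
exists (fun u v => \row_j d j u v), (fun u v => \row_j e j u v).
split=> [u a v w|u a v w|u a v w|u v usl vsl]; apply/rowP => j;
  have [dl el er fE] := te j; rewrite !mxE.
- exact: dl.
- exact: (el u a v w).
- exact: er.
- by rewrite !phiE ?fE//; exact: sl_add.
Qed.

End SecondOrderTaylor.

(** * Transvections *)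

Section Transvections.
Context {F : fieldType} {n : nat}.
Implicit Types (A : 'M[F]_n) (i j : 'I_n) (r : F).

Definition transvection i j r : 'M[F]_n := 1%:M + r *: delta_mx i j.

Lemma mul_transvectionE i j r A a b :
  (transvection i j r *m A) a b = A a b + (a == i)%:R * (r * A j b).
Proof.
rewrite mulmxDl mul1mx -scalemxAl !mxE; congr (_ + _).
rewrite (bigD1 j)//= big1 ?addr0 => [|k kj]; rewrite !mxE ?eqxx ?andbT.
  by rewrite mulrCA.
by rewrite (negPf kj) andbF mul0r.
Qed.

Lemma tr_transvection i j r : (transvection i j r)^T = transvection j i r.
Proof. by rewrite linearD linearZ /= trmx1 trmx_delta. Qed.

Lemma det_transvection i j r : i != j -> \det (transvection i j r) = 1.
Proof.
have lower (k l : 'I_n) : (l < k)%N -> \det (transvection k l r) = 1.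
  move=> lk; rewrite det_trig; last first.
    apply/is_trig_mxP => a b ab; rewrite !mxE -!val_eqE /=.
    have -> : (a == b :> nat) = false by apply/eqP; lia.
    have -> : (a == k :> nat) && (b == l :> nat) = false.
      by apply/negP => /andP[/eqP ak /eqP bl]; lia.
    by rewrite mulr0 addr0.
  rewrite big1// => a _; rewrite !mxE eqxx -!val_eqE /=.
  have -> : (a == k :> nat) && (a == l :> nat) = false.
    by apply/negP => /andP[/eqP ak /eqP al]; lia.
  by rewrite mulr0 addr0.
move=> ij; case: (ltngtP i j) => [lt|lt|/val_inj e].
- by rewrite -det_tr tr_transvection lower.
- exact: lower.
- by rewrite e eqxx in ij.
Qed.

Lemma mul_transvectionK i j r : i != j ->
  transvection i j (- r) *m transvection i j r = 1%:M.
Proof.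
move=> ij; apply/matrixP => a b; rewrite mul_transvectionE !mxE.
have -> : (j == i) = false by rewrite eq_sym (negPf ij).
by rewrite [j == b]eq_sym -mulnb natrM /=; ring.
Qed.

(** ** Generation of the special linear group *)

Variable P : 'M[F]_n -> Prop.
Hypothesis P1 : P 1%:M.
Hypothesis PM : forall i j r A, i != j -> P A -> P (transvection i j r *m A).

Let cancel i j r A : i != j -> P (transvection i j r *m A) -> P A.
Proof.
move=> ij /(PM (- r) ij); rewrite mulmxA mul_transvectionK ?mul1mx//.
Qed.

Let reduced (k : nat) A := forall a b : 'I_n, (b < k)%N -> A a b = (a == b)%:R.

Let clear_column k A (c : 'I_n) : c = k :> nat -> reduced k A -> A c c = 1 ->
  (forall B, reduced k.+1 B -> \det B = \det A -> P B) -> P A.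
Proof.
move=> ck rA Acc H.
(* [s] lists the rows that may still have a nonzero entry in column [c]. *)
suff G (s : seq 'I_n) A' : reduced k A' -> A' c c = 1 -> \det A' = \det A ->
   (forall a, a \notin s -> a != c -> A' a c = 0) -> P A'.
  by apply: (G (enum 'I_n)) => // a; rewrite mem_enum.
elim: s A' => [|i s IH] A' rA' A'c dA' H'.
  apply: H => // a b; rewrite ltnS leq_eqVlt => /orP[/eqP bk|/rA'//].
  have -> : b = c by apply: val_inj; rewrite /= bk ck.
  have [->//|ac] := eqVneq a c; exact: H'.
have [ic|ic] := eqVneq i c.
  apply: IH => // a as_ ac; apply: H' => //; rewrite in_cons ic negb_or ac//.
apply: (@cancel i c (- A' i c)) => //; apply: IH.
- move=> a b bk; rewrite mul_transvectionE rA'// [A' c b]rA'//.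
  have -> : (c == b) = false by rewrite -val_eqE /= ck; apply/eqP; lia.
  by rewrite !mulr0 addr0.
- by rewrite mul_transvectionE eq_sym (negPf ic) mul0r addr0.
- by rewrite det_mulmx det_transvection// mul1r.
- move=> a as_ ac; rewrite mul_transvectionE A'c.
  have [->|ai] := eqVneq a i; first by rewrite mul1r mulr1 addrN.
  by rewrite mul0r addr0 H'// in_cons negb_or ai.
Qed.

(** Gaussian elimination by columns: once the first [k] columns are those of the
    identity, adding a multiple of a row of index at least [k] to another row does
    not disturb them.  A pivot equal to 1 in column [k] is produced with the help
    of a lower row; only the last column has no such row, and there the
    determinant gives the pivot. *)
Lemma SL_transvection_ind A : \det A = 1 -> P A.
Proof.
suff G (p k : nat) B : (p + k = n)%N -> reduced k B -> \det B = 1 -> P B.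
  by move=> dA; apply: (G n 0%N A) => //; rewrite addn0.
elim: p k B => [k B kn rB _|p IH k B pk rB dB].
  suff -> : B = 1%:M by [].
  by apply/matrixP => a b; rewrite rB ?mxE//; have := ltn_ord b; lia.
have kn : (k < n)%N by lia.
pose c := Ordinal kn.
have IH' B' : reduced k.+1 B' -> \det B' = 1 -> P B'.
  by apply: IH; lia.
(* Otherwise column [k] would be a combination of the previous ones. *)
have [i [ik Bi]] : exists i : 'I_n, (k <= i)%N /\ B i c != 0.
  apply: contrapT => H.
  have Bu : B \in unitmx by rewrite unitmxE dB unitr1.
  have B0 (i : 'I_n) : (k <= i)%N -> B i c = 0.
    by move=> ki; apply/eqP/negPn/negP => Bi; apply: H; exists i.
  pose w : 'cV[F]_n :=
    \col_j (if j == c then 1 else if (j < k)%N then - B j c else 0).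
  have : B *m w = 0.
    apply/colP => a; rewrite !mxE (bigD1 c)//= mxE eqxx mulr1.
    have [ak|ak] := ltnP a k.
      rewrite (bigD1 a)/=; last by rewrite -val_eqE /=; apply/eqP; lia.
      rewrite mxE [B a a]rB// eqxx mul1r ak.
      have -> : (a == c) = false by rewrite -val_eqE /=; apply/eqP; lia.
      rewrite big1 ?addr0 ?subrr// => j /andP[jc ja]; rewrite mxE (negPf jc).
      case: ifP => jk; last by rewrite mulr0.
      by rewrite rB// eq_sym (negPf ja) mul0r.
    rewrite B0// add0r big1// => j jc; rewrite mxE (negPf jc).
    case: ifP => jk; last by rewrite mulr0.
    rewrite rB//.
    have -> : (a == j) = false by rewrite -val_eqE /=; apply/eqP; lia.
    by rewrite mul0r.
  move/(congr1 (mulmx (invmx B))); rewrite mulKmx// mulmx0 => /colP/(_ c).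
  by rewrite !mxE eqxx => /eqP; rewrite oner_eq0.
have red (i' j' : 'I_n) r B' : (k <= j')%N -> reduced k B' ->
    reduced k (transvection i' j' r *m B').
  move=> kj rB' a b bk; rewrite mul_transvectionE rB'// [B' j' b]rB'//.
  have -> : (j' == b) = false by rewrite -val_eqE /=; apply/eqP; lia.
  by rewrite !mulr0 addr0.
have dett (i' j' : 'I_n) r B' : i' != j' -> \det B' = 1 ->
    \det (transvection i' j' r *m B') = 1.
  by move=> ij dB'; rewrite det_mulmx det_transvection// mul1r.
have main B' (j : 'I_n) : reduced k B' -> \det B' = 1 -> (k < j)%N ->
    B' j c != 0 -> P B'.
  move=> rB' dB' kj Bj.
  have cj : c != j by rewrite -val_eqE /=; apply/eqP; lia.
  apply: (@cancel c j ((1 - B' c c) / B' j c)) => //.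
  apply: (@clear_column k _ c) => //.
  - by apply: red => //; exact: ltnW.
  - by rewrite mul_transvectionE eqxx mul1r divfK// addrC subrK.
  - by move=> B'' rB'' dB''; apply: IH' => //; rewrite dB''; exact: dett.
have [ki|ki] := ltnP k i; first exact: (main B i).
have ic : i = c by apply: val_inj => /=; apply/eqP; rewrite eqn_leq ki ik.
have [k1n|k1n] := ltnP k.+1 n.
  pose j := Ordinal k1n.
  have jc : j != c by rewrite -val_eqE /=; apply/eqP; lia.
  have [Bj|Bj] := eqVneq (B j c) 0; last by apply: (main B j) => //=.
  apply: (@cancel j c 1) => //; apply: (main _ j) => //=.
  - exact: red.
  - exact: dett.
  - by rewrite mul_transvectionE eqxx Bj add0r !mul1r; move: Bi; rewrite ic.
apply: (@clear_column k _ c) => //; last first.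
  by move=> B' rB' dB'; apply: IH' => //; rewrite dB'.
(* Last column: [B] is triangular and its other diagonal entries are 1. *)
move: dB; rewrite -det_tr det_trig; last first.
  apply/is_trig_mxP => a b ab; rewrite mxE rB; last by have := ltn_ord b; lia.
  by have -> : (b == a) = false by rewrite -val_eqE /=; apply/eqP; lia.
rewrite (bigD1 c)//= big1 ?mulr1 ?mxE// => a ac; rewrite mxE rB ?eqxx//.
move: ac; rewrite -val_eqE /= => /eqP; have := ltn_ord a; lia.
Qed.

End Transvections.

(** * Conjugation of diagonal matrices by transvections *)

Section DiagonalMatrices.
Context {F : fieldType} {n : nat}.
Implicit Types (X : 'M[F]_n) (i j : 'I_n) (r z : F) (delta : 'rV[F]_n).

Lemma mul_diag_delta delta i j :
  diag_mx delta *m delta_mx i j = delta 0 i *: delta_mx i j.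
Proof.
apply/matrixP => a b; rewrite mul_diag_mx !mxE.
by have [->|] := eqVneq a i; rewrite ?andbF //= ?mulr0 // mulr0.
Qed.

Lemma mul_delta_diag delta i j :
  delta_mx i j *m diag_mx delta = delta 0 j *: delta_mx i j.
Proof.
apply/matrixP => a b; rewrite mul_mx_diag !mxE mulrC.
by have [->|] := eqVneq b j; rewrite ?andbF ?mulr0.
Qed.

Lemma delta_mx_nilpotent i j : i != j ->
  delta_mx i j *m delta_mx i j = 0 :> 'M[F]_n.
Proof. by move=> ij; rewrite mul_delta_mx_cond eq_sym (negPf ij) mulr0n. Qed.

Lemma transvectionN_mulK i j r : i != j ->
  transvection i j r *m transvection i j (- r) = 1%:M.
Proof. by move=> ij; rewrite -{1}[r]opprK mul_transvectionK. Qed.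

Lemma transvection_inv i j r : i != j ->
  invmx (transvection i j r) = transvection i j (- r).
Proof.
move=> ij.
have u : transvection i j r \in unitmx.
  by rewrite unitmxE det_transvection ?unitr1.
by rewrite -[RHS](mulKmx u) transvectionN_mulK// mulmx1.
Qed.

Lemma transvection_conj i j r X : i != j ->
  transvection i j r *m X *m invmx (transvection i j r) =
  X + r *: (delta_mx i j *m X - X *m delta_mx i j)
    - r ^+ 2 *: (delta_mx i j *m X *m delta_mx i j).
Proof.
move=> ij; rewrite transvection_inv// /transvection.
rewrite mulmxDr mulmx1 !mulmxDl mul1mx -!scalemxAl -!scalemxAr.
by apply/matrixP => a b; rewrite !mxE; ring.
Qed.

Lemma transvection_conj_diag i j r delta : i != j ->
  transvection i j r *m diag_mx delta *m invmx (transvection i j r) =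
  diag_mx delta + (r * (delta 0 j - delta 0 i)) *: delta_mx i j.
Proof.
move=> ij; rewrite transvection_conj// mul_delta_diag mul_diag_delta.
rewrite -scalemxAl delta_mx_nilpotent// !scaler0 subr0.
by rewrite -scalerBl scalerA.
Qed.

Lemma transvection_conj_delta i j r : i != j ->
  transvection i j r *m delta_mx i j *m invmx (transvection i j r) =
  delta_mx i j.
Proof.
move=> ij; rewrite transvection_conj// delta_mx_nilpotent// mul0mx.
by rewrite subrr !scaler0 addr0 subr0.
Qed.

Lemma transvection_conj_deltaC i j r : i != j ->
  transvection i j r *m delta_mx j i *m invmx (transvection i j r) =
  delta_mx j i + r *: (delta_mx i i - delta_mx j j) - r ^+ 2 *: delta_mx i j.
Proof.
by move=> ij; rewrite transvection_conj// !mul_delta_mx.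
Qed.

Definition swap_diag i j delta : 'rV[F]_n :=
  \row_k (if k == i then delta 0 j else if k == j then delta 0 i else delta 0 k).

(** The hypothesis on [z r] makes the [E_ij] entry of the conjugate,
    [r (delta_j - delta_i) - r ^ 2 z], vanish, so that only its eigenvalues on the
    diagonal change places. *)
Lemma transvection_conj_swap i j r z delta : i != j ->
  z * r = delta 0 j - delta 0 i ->
  transvection i j r *m (diag_mx delta + z *: delta_mx j i) *m
    invmx (transvection i j r) =
  diag_mx (swap_diag i j delta) + z *: delta_mx j i.
Proof.
move=> ij zr; rewrite mulmxDr mulmxDl transvection_conj_diag//.
rewrite -scalemxAr -scalemxAl transvection_conj_deltaC//.
have dj : delta 0 j = delta 0 i + z * r by rewrite zr addrC subrK.
have ji : (j == i) = false by rewrite eq_sym (negPf ij).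
have ij' := negPf ij.
apply/matrixP => a b; rewrite !mxE.
have [->|ai] := eqVneq a i.
  have [->|bi] := eqVneq b i; rewrite ?eqxx ?ij' /=.
    by rewrite !mulr1n dj; ring.
  by have [_|_] := eqVneq b j; rewrite ?dj /=; ring.
have [->|aj] := eqVneq a j.
  have [->|bi] := eqVneq b i; rewrite ?eqxx ?ij' ?ji /=; first by ring.
  by have [_|_] := eqVneq b j; rewrite /= ?mulr1n ?mulr0n ?dj; ring.
by rewrite /=; ring.
Qed.

End DiagonalMatrices.

(** * Rigidity at a diagonal matrix *)

Section DiagonalRigidity.
Context {R : realType} {n m : nat}.
Variables (pi : 'M[R]_n -> 'M[R]_m) (phi : 'M[R]_n -> 'rV[R]_m).
Hypothesis rep : representation pi.
Hypothesis equiv : forall g xi, SL g -> sl xi ->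
  phi (g *m xi *m invmx g) *m pi g = phi xi.
Hypothesis trans : forall xi theta (v : 'cV[R]_m), sl xi -> sl theta ->
  (forall X, sl X -> \tr (theta *m X) =
     (phi xi *m 'd pi (1%:M : 'M[R]_n) X *m v) 0 0) ->
  phi (xi + theta) = phi xi.
Variables d e : 'M[R]_n -> 'M[R]_n -> 'rV[R]_m.
Hypothesis te : taylor2 sl phi d e.

(** Differentiating the equivariance at the identity gives
    [phi xi (pi' N) = d xi [xi, N]].  For a square-zero [N] the curve [1 + s N]
    stays in [SL(n)] and its inverse is [1 - s N], so that both sides of the
    equivariance are explicit in [s]. *)
Lemma derivative_nilpotent xi (N : 'M[R]_n) : sl xi -> N *m N = 0 ->
  (forall s, SL (1%:M + s *: N)) ->
  phi xi *m 'd pi (1%:M : 'M[R]_n) N = d xi (xi *m N - N *m xi).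
Proof.
move=> xisl NN SLN; have [pi1 piM dpi] := rep.
have mulN s : (1%:M - s *: N) *m (1%:M + s *: N) = 1%:M.
  rewrite mulmxDr mulmxBl mulmxBl !mul1mx mulmx1 -scalemxAl -scalemxAr NN.
  by rewrite !scaler0 subr0 subrK.
have inv s : invmx (1%:M - s *: N) = 1%:M + s *: N.
  have u : 1%:M - s *: N \in unitmx by case/mulmx1_unit: (mulN s).
  by have := mulKmx u (1%:M + s *: N); rewrite mulN mulmx1.
pose Z := xi *m N - N *m xi; pose W := - (N *m xi *m N).
have Zsl : sl Z by rewrite /sl /= linearB /= mxtrace_mulC subrr.
have Wsl : sl W.
  by rewrite /sl /= linearN /= mxtrace_mulC mulmxA NN mul0mx raddf0 oppr0.
have conj s : (1%:M - s *: N) *m xi *m (1%:M + s *: N) =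
    xi + (s *: Z + s ^+ 2 *: W).
  rewrite mulmxDr mulmxBl mulmx1 mul1mx mulmxBl -!scalemxAl -!scalemxAr /Z /W.
  by apply/matrixP => i j; rewrite !mxE; ring.
pose rest s := d xi W + e Z Z + s *: (e Z W + e W Z + s *: e W W).
have expand s : phi xi *m pi (1%:M + s *: N) =
    phi xi + s *: (d xi Z + s *: rest s).
  have SLs : SL (1%:M - s *: N) by rewrite -scaleNr; exact: SLN.
  rewrite -[in LHS](equiv SLs xisl) inv conj -mulmxA -piM// mulN pi1 mulmx1.
  rewrite (taylor2_plane te)//; last by apply: sl_add; exact: sl_scale.
  rewrite -addrA; congr (_ + _); rewrite /rest.
  by apply/rowP => j; rewrite !mxE; ring.
pose quotient (h : R) := phi xi *m (h^-1 *: (pi (h *: N + 1%:M) - pi 1%:M)).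
have lim_pi : quotient @ 0^' --> phi xi *m 'd pi (1%:M : 'M[R]_n) N.
  have dpi1 := dpi _ (@SL1 R n).
  have lim : (fun h : R => h^-1 *: (pi (h *: N + 1%:M) - pi 1%:M)) @ 0^' -->
      'd pi (1%:M : 'M[R]_n) N.
    by rewrite -deriveE//; exact: diff_derivable.
  exact: (cvg_comp _ _ lim (@mx_linear_continuous _ _ _ _ (mulmx (phi xi)) _)).
have lim_phi : quotient @ 0^' --> d xi Z.
  apply: (@cvg_trans _ ((fun h : R => d xi Z + h *: rest h) @ 0^')).
    apply: near_eq_cvg; near=> h.
    have h0 : h != 0 by near: h; exact: nbhs_dnbhs_neq.
    rewrite /quotient -scalemxAr mulmxBr [h *: N + _]addrC expand pi1 mulmx1.
    by rewrite [phi xi + _]addrC addrK scalerA mulVf// scale1r.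
  apply: cvg_within_filter.
  suff : (fun h : R => d xi Z + h *: rest h) @ 0 --> d xi Z + (0 : R) *: rest 0.
    by rewrite scale0r addr0.
  by do 3?[apply: cvgD; [exact: cvg_cst|apply: cvgZ; first exact: cvg_id]];
    exact: cvg_cst.
exact: (cvg_unique _ lim_pi lim_phi).
Unshelve. all: by end_near. Qed.

Variable delta : 'rV[R]_n.
Let D := diag_mx delta.
Hypothesis D_sl : sl D.
Let E i j : 'M[R]_n := delta_mx i j.
Let beta i j := d D (E i j).

Let line i j s : i != j ->
  phi (D + s *: E i j) = phi D + s *: beta i j + s ^+ 2 *: e (E i j) (E i j).
Proof.
by move=> ij; rewrite (taylor2_line te)//; apply: sl_scale; exact: sl_delta.
Qed.

Let line_sl i j s : i != j -> sl (D + s *: E i j).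
Proof. by move=> ij; apply: sl_add => //; apply: sl_scale; exact: sl_delta. Qed.

Let SL_transvection i j s : i != j -> SL (transvection i j s : 'M[R]_n).
Proof. exact: det_transvection. Qed.

(** If [phi] is constant on the line of direction [E_ji], then conjugation by
    [1 + (y / c) E_ij], with [c = delta_j - delta_i], identifies its value at
    [D + y E_ij] with its value at [D' + (c ^ 2 / y) E_ji], where [D'] is the
    swapped matrix.  A polynomial in [y] that is also a polynomial in [1 / y] is
    constant. *)
Lemma constant_on_opposite_line i j : i != j -> delta 0 i != delta 0 j ->
  (forall z, phi (D + z *: E j i) = phi D) ->
  (forall z, phi (D + z *: E i j) = phi D) /\
  phi (diag_mx (swap_diag i j delta)) = phi D.
Proof.
move=> ij dij const; have ji : j != i by rewrite eq_sym.
pose D' := diag_mx (swap_diag i j delta); rewrite -/D'.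
pose c := delta 0 j - delta 0 i.
have D'sl : sl D'.
  have Eji := sl_delta (R := R) ji.
  rewrite -[D'](addrK (c *: E j i)) -scaleNr; apply: sl_add; last exact: sl_scale.
  rewrite -(transvection_conj_swap ij (mulr1 c)).
  by apply: sl_conj; [exact: SL_transvection|exact: line_sl].
have c0 : c != 0 by rewrite subr_eq0 eq_sym.
pose b' := c ^+ 2 *: d D' (E j i); pose e' := c ^+ 4 *: e (E j i) (E j i).
have key y : y != 0 ->
    phi D + y *: beta i j + y ^+ 2 *: e (E i j) (E i j) =
    phi D' + y^-1 *: b' + y^-1 ^+ 2 *: e'.
  move=> y0; rewrite -line//.
  pose z := c ^+ 2 / y.
  have zr : z * (y / c) = delta 0 j - delta 0 i.
    by rewrite -/c /z; field; rewrite y0 c0.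
  transitivity (phi (D' + z *: E j i)).
    have St := SL_transvection (y / c) ij.
    apply: (representation_inj rep St).
    rewrite -(transvection_conj_swap ij zr) [RHS]equiv//; last exact: line_sl.
    rewrite const -[in RHS](equiv St D_sl) transvection_conj_diag//.
    by rewrite -/c divfK.
  rewrite (taylor2_line te)//; last by apply: sl_scale; exact: sl_delta.
  rewrite /b' /e' !scalerA /z; congr (_ + _ *: _ + _ *: _); first by rewrite mulrC.
  by rewrite exprMn -exprM mulrC.
suff sep k : [/\ beta i j 0 k = 0, e (E i j) (E i j) 0 k = 0 &
    phi D' 0 k = phi D 0 k].
  have b0 : beta i j = 0 by apply/rowP => k; rewrite [RHS]mxE; case: (sep k).
  have e0 : e (E i j) (E i j) = 0.
    by apply/rowP => k; rewrite [RHS]mxE; case: (sep k).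
  split; first by move=> z; rewrite line// b0 e0 !scaler0 !addr0.
  by apply/rowP => k; case: (sep k).
(* Times [y ^ 2] this is a quartic in [y]: five values of [y] determine it. *)
have k1 := key 1 (oner_neq0 _).
have /key k2 : -1 != 0 :> R by rewrite oppr_eq0 oner_eq0.
have /key k3 : 2 != 0 :> R by rewrite pnatr_eq0.
have /key k4 : -2 != 0 :> R by rewrite oppr_eq0 pnatr_eq0.
have /key k5 : 3 != 0 :> R by rewrite pnatr_eq0.
move: k1 k2 k3 k4 k5 => /rowP/(_ k) k1 /rowP/(_ k) k2 /rowP/(_ k) k3.
move=> /rowP/(_ k) k4 /rowP/(_ k) k5; move: k1 k2 k3 k4 k5; rewrite !mxE.
move: (c ^+ 2 * d D' (E j i) 0 k) (c ^+ 4 * e (E j i) (E j i) 0 k) => y1 y2.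
move: (phi D 0 k) (beta i j 0 k) (e (E i j) (E i j) 0 k) (phi D' 0 k).
by move=> x0 x1 x2 y0 k1 k2 k3 k4 k5; split; lra.
Qed.

(** Conjugation by a transvection translates the line by 1, so that the same
    operator [pi U] sends the values of [phi] at the parameters [-1] and [1] to
    those at [-2] and [0].  With [beta = 0] the former agree, hence
    [phi (D - 2 E_ij) = phi D] and the quadratic coefficient vanishes. *)
Lemma constant_of_beta_eq0 i j : i != j -> delta 0 i != delta 0 j ->
  beta i j = 0 -> forall z, phi (D + z *: E i j) = phi D.
Proof.
move=> ij dij b0 z.
suff e0 : e (E i j) (E i j) = 0 by rewrite line// b0 e0 !scaler0 !addr0.
have c0 : delta 0 j - delta 0 i != 0 by rewrite subr_eq0 eq_sym.
pose r := (delta 0 j - delta 0 i)^-1; pose U := transvection i j r : 'M[R]_n.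
have SU : SL U by exact: SL_transvection.
have shift s : phi (D + (s + 1) *: E i j) *m pi U = phi (D + s *: E i j).
  rewrite -[RHS](equiv SU); last exact: line_sl.
  congr (phi _ *m _); rewrite mulmxDr mulmxDl transvection_conj_diag//.
  rewrite -scalemxAr -scalemxAl transvection_conj_delta// mulVf//.
  by rewrite -addrA -scalerDl addrC [1 + s]addrC addrC.
have := shift (-2); rewrite (_ : -2 + 1 = -1 :> R); last by ring.
have := shift 0; rewrite add0r !line// b0 !scaler0 !addr0.
rewrite sqrrN => ->; rewrite expr0n scale0r addr0.
move/eqP; rewrite -subr_eq0 opprD addrA subrr add0r oppr_eq0 scaler_eq0.
by rewrite sqrf_eq0 oppr_eq0 pnatr_eq0 /= => /eqP.
Qed.

Let deriv (N : 'M[R]_n) : N *m N = 0 -> (forall s, SL (1%:M + s *: N)) ->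
  phi D *m 'd pi (1%:M : 'M[R]_n) N = d D (D *m N - N *m D).
Proof. exact: derivative_nilpotent. Qed.

Let a (X : 'M[R]_n) : 'rV[R]_m := phi D *m 'd pi (1%:M : 'M[R]_n) X.

Let a_scale s X : a (s *: X) = s *: a X.
Proof. by rewrite /a linearZ /= -scalemxAr. Qed.

Let a_add X Y : a (X + Y) = a X + a Y.
Proof. by rewrite /a linearD /= mulmxDr. Qed.

Let a_opp X : a (- X) = - a X.
Proof. by rewrite /a linearN /= mulmxN. Qed.

Lemma derivative_delta i j : i != j ->
  a (E i j) = (delta 0 i - delta 0 j) *: beta i j.
Proof.
move=> ij; rewrite /a deriv; last by move=> s; exact: SL_transvection.
  rewrite mul_diag_delta mul_delta_diag -scalerBl.
  by have [dl _ _ _] := te; rewrite (linear_funZ (dl D)).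
exact: delta_mx_nilpotent.
Qed.

(** The derivative along the torus vanishes, because [D] commutes with it.  As
    [E_ii - E_jj] is not nilpotent, it is obtained from the nilpotent conjugate
    [E_ji + E_ii - E_jj - E_ij] of [E_ji]. *)
Lemma derivative_diag i j : a (E i i) = a (E j j).
Proof.
have [->//|ij] := eqVneq i j; have ji : j != i by rewrite eq_sym.
pose U := transvection i j 1 : 'M[R]_n.
have SU : SL U by exact: SL_transvection.
pose N := U *m E j i *m invmx U.
have NE : N = E j i + (E i i - E j j) - E i j.
  by rewrite /N transvection_conj_deltaC// !scale1r expr1n scale1r.
have NN : N *m N = 0.
  rewrite /N -!mulmxA [invmx U *m _]mulmxA mulVmx ?SL_unit// mul1mx.
  by rewrite [E j i *m (E j i *m _)]mulmxA delta_mx_nilpotent// mul0mx mulmx0.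
have SN s : SL (1%:M + s *: N).
  have -> : 1%:M + s *: N = U *m transvection j i s *m invmx U.
    rewrite /transvection mulmxDr mulmxDl mulmx1 mulmxV ?SL_unit//.
    by rewrite -scalemxAr -scalemxAl.
  apply: SL_mul; last exact: SL_inv.
  by apply: SL_mul => //; exact: SL_transvection.
have aN : a N = a (E j i) - a (E i j).
  rewrite !derivative_delta// /a deriv// NE.
  have -> : D *m (E j i + (E i i - E j j) - E i j) -
        (E j i + (E i i - E j j) - E i j) *m D
      = (delta 0 j - delta 0 i) *: E j i + (- (delta 0 i - delta 0 j)) *: E i j.
    rewrite !(mulmxDl, mulmxDr, mulmxN, mulNmx) !mul_diag_delta !mul_delta_diag.
    by apply/matrixP => k l; rewrite !mxE; ring.
  by have [dl _ _ _] := te; rewrite (linear_fun2 (dl D)) scaleNr.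
move: aN; rewrite NE !a_add !a_opp.
move: (a (E i i)) (a (E j j)) (a (E i j)) (a (E j i)) => x y z w.
by move=> /rowP h; apply/rowP => k; have := h k; rewrite !mxE; lra.
Qed.

(** The traceless matrix that represents [X |-> a X v]. *)
Let theta (v : 'cV[R]_m) : 'M[R]_n :=
  \matrix_(k, l) ((delta 0 l - delta 0 k) * (beta l k *m v) 0 0).

Let theta_sl v : sl (theta v).
Proof. by rewrite /sl /= /mxtrace big1// => k _; rewrite mxE subrr mul0r. Qed.

Let theta_pairing v X : sl X -> \tr (theta v *m X) = (a X *m v) 0 0.
Proof.
move=> Xsl.
have a_diag : \sum_l X l l *: a (E l l) = 0.
  case: (pickP (fun _ : 'I_n => true)) => [l0 _|no]; last first.
    by rewrite big1// => l; have := no l.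
  under eq_bigr do rewrite (derivative_diag _ l0).
  by rewrite -scaler_suml (_ : \sum_i X i i = 0) ?scale0r.
have -> : a X = \sum_l \sum_k (X l k * (delta 0 l - delta 0 k)) *: beta l k.
  transitivity (\sum_l \sum_k X l k *: a (E l k)).
    rewrite /a {1}(matrix_sum_delta X) linear_sum /= mulmx_sumr.
    apply: eq_bigr => l _; rewrite linear_sum /= mulmx_sumr.
    by apply: eq_bigr => k _; rewrite linearZ /= -scalemxAr.
  transitivity (\sum_l (\sum_k (X l k * (delta 0 l - delta 0 k)) *: beta l k +
      X l l *: a (E l l))); last by rewrite big_split /= a_diag addr0.
  apply: eq_bigr => l _; rewrite (bigD1 l)//= [in RHS](bigD1 l)//=.
  rewrite subrr mulr0 scale0r add0r addrC; congr (_ + _).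
  apply: eq_bigr => k kl; rewrite derivative_delta ?scalerA//.
  by rewrite eq_sym.
rewrite mulmx_suml summxE /mxtrace.
rewrite [LHS](eq_bigr (fun k =>
  \sum_l X l k * (delta 0 l - delta 0 k) * (beta l k *m v) 0 0)).
  rewrite exchange_big /=; apply: eq_bigr => l _; rewrite mulmx_suml summxE.
  by apply: eq_bigr => k _; rewrite -scalemxAl [RHS]mxE.
by move=> k _; rewrite mxE; apply: eq_bigr => l _; rewrite mxE mulrC mulrA.
Qed.

Let theta_translation v : phi (D + theta v) = phi D.
Proof. by apply: (trans (v := v)) => // X; exact: theta_pairing. Qed.

Lemma torus_weight (tau : 'rV[R]_n) i j : i != j ->
  (forall k, tau 0 k != 0) -> SL (diag_mx tau) ->
  beta i j *m pi (diag_mx tau) = (tau 0 j / tau 0 i) *: beta i j.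
Proof.
move=> ij tau0 tauSL; pose t := diag_mx tau; pose lam := tau 0 j / tau 0 i.
have scaled s : phi (D + s *: E i j) *m pi t = phi (D + (s * lam) *: E i j).
  rewrite -[RHS](equiv tauSL); last exact: line_sl.
  congr (phi _ *m _).
  apply: (canRL (mulmxK (SL_unit tauSL))); rewrite mulmxDl mulmxDr diag_mxC.
  rewrite -scalemxAl -scalemxAr mul_diag_delta mul_delta_diag !scalerA.
  by congr (_ + _ *: _); rewrite /lam; field.
have p0 : phi D *m pi t = phi D.
  by have := scaled 0; rewrite mul0r !scale0r addr0.
have p1 := scaled 1; have p2 := scaled (-1).
move: p1 p2; rewrite !line// !mulmxDl p0 -!scalemxAl.
rewrite -/t -/lam; move: {scaled} (beta i j *m pi t) (e (E i j) (E i j) *m pi t).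
move: (beta i j) (e _ _) lam => b c lam x y /rowP p1 /rowP p2; apply/rowP => k.
by have := p1 k; have := p2 k; rewrite !mxE; lra.
Qed.

(** For [tau] with entries [1/2] at [i], [2] at [j] and 1 elsewhere, the weight
    of [beta i j] is 4 and the other weights are [1/4], [1/2], 1 and 2.  The
    product of the operators [pi tau - mu] over these four values of [mu]
    therefore kills all [beta k l] but [beta i j]. *)
Lemma isolate_root i j : i != j -> delta 0 i != delta 0 j -> beta i j != 0 ->
  exists v : 'cV[R]_m, theta v = E j i.
Proof.
move=> ij dij b0.
have [v bv] : exists v : 'cV[R]_m, beta i j *m v = 1%:M.
  case/rV0Pn: b0 => k bk; exists ((beta i j 0 k)^-1 *: delta_mx k 0).
  apply/matrixP => x y; rewrite !ord1 mxE (bigD1 k)//= !mxE !eqxx mulr1 divff//.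
  by rewrite big1 ?addr0// => l lk; rewrite !mxE (negPf lk) /= !mulr0.
pose tau : 'rV[R]_n := \row_k (if k == i then 2^-1 else if k == j then 2 else 1).
have tau0 k : tau 0 k != 0.
  by rewrite mxE; do 2?case: ifP => _; rewrite ?invr_eq0 ?pnatr_eq0 ?oner_neq0.
have tauSL : SL (diag_mx tau).
  rewrite /SL /= det_diag (bigD1 i)//= (bigD1 j)/=; last by rewrite eq_sym.
  rewrite !mxE eqxx [j == i]eq_sym (negPf ij) eqxx big1.
    by rewrite mulr1 mulVf ?pnatr_eq0.
  by move=> k /andP[ki kj]; rewrite mxE (negPf ki) (negPf kj).
pose f mu (w : 'cV[R]_m) := pi (diag_mx tau) *m w - mu *: w.
have bf k l mu w : k != l ->
    beta k l *m f mu w = (tau 0 l / tau 0 k - mu) *: (beta k l *m w).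
  move=> kl; rewrite /f mulmxBr mulmxA torus_weight// -scalemxAl -scalemxAr.
  by rewrite -scalerBl.
pose v' := f (4^-1) (f (2^-1) (f 1 (f 2 v))).
pose kappa : R := (4 - 4^-1) * ((4 - 2^-1) * ((4 - 1) * (4 - 2))).
have kappa0 : kappa != 0 by rewrite /kappa; apply/eqP; lra.
exists ((kappa * (delta 0 i - delta 0 j))^-1 *: v').
apply/matrixP => k l; rewrite [LHS]mxE [RHS]mxE -scalemxAr.
have [->|lk] := eqVneq l k.
  rewrite subrr mul0r; have [->|//] := eqVneq k j.
  by rewrite [j == i]eq_sym (negPf ij).
rewrite /v' !bf// !scalerA; set q := tau 0 k / tau 0 l.
have [/andP[/eqP kj /eqP li]|kl] := boolP ((k == j) && (l == i)).
  have -> : q = 4.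
    by rewrite /q kj li !mxE !eqxx [j == i]eq_sym (negPf ij) invrK -natrM.
  have -> : (4 - 4^-1) * (4 - 2^-1) * (4 - 1) * (4 - 2) = kappa.
    by rewrite /kappa -!mulrA.
  rewrite kj li bv !mxE !eqxx /= mulr1.
  by field; rewrite kappa0 subr_eq0 dij.
have : [\/ q = 4^-1, q = 2^-1, q = 1 | q = 2].
  have ji : (j == i) = false by rewrite eq_sym (negPf ij).
  rewrite /q !mxE; have [ki|ki] := eqVneq k i.
    have li : (l == i) = false by rewrite -ki (negPf lk).
    rewrite li; case: ifP => _; [apply: Or41|apply: Or42]; last by rewrite divr1.
    by rewrite -invfM -natrM.
  have [kj|kj] := eqVneq k j.
    move: kl lk; rewrite kj eqxx /= => /negPf -> /negPf ->.
    by apply: Or44; rewrite divr1.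
  case: ifP => _; first by apply: Or44; rewrite mul1r invrK.
  by case: ifP => _; [apply: Or42|apply: Or43]; rewrite mul1r ?invr1.
by case=> ->; rewrite subrr !(mul0r, mulr0) scale0r mxE mulr0.
Qed.

Lemma opposite_of_beta_neq0 i j : i != j -> delta 0 i != delta 0 j ->
  beta i j != 0 -> forall z, phi (D + z *: E j i) = phi D.
Proof.
move=> ij dij b0 z; have [v <-] := isolate_root ij dij b0.
have -> : z *: theta v = theta (z *: v).
  apply/matrixP => k l; rewrite [LHS]mxE [X in _ * X]mxE [RHS]mxE.
  by rewrite -scalemxAr [X in _ = _ * X]mxE mulrCA.
exact: theta_translation.
Qed.

(** Depending on [beta i j], [phi] is constant on one or the other of the lines
    of directions [E_ij] and [E_ji], and constancy passes between them. *)
Lemma diagonal_rigidity i j : i != j -> delta 0 i != delta 0 j ->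
  (forall z, phi (D + z *: E i j) = phi D) /\
  phi (diag_mx (swap_diag i j delta)) = phi D.
Proof.
move=> ij dij; have [b0|b0] := eqVneq (beta i j) 0; last first.
  by apply: constant_on_opposite_line => //; exact: opposite_of_beta_neq0.
have c := constant_of_beta_eq0 ij dij b0; split=> //.
have -> : swap_diag i j delta = swap_diag j i delta.
  apply/rowP => k; rewrite !mxE; have [->|//] := eqVneq k i.
  by rewrite (negPf ij).
have [] // := @constant_on_opposite_line j i; rewrite eq_sym//.
Qed.

End DiagonalRigidity.

(** * The convex hull of the orbit of a diagonal matrix *)

Section MidpointHull.
Context {R : realType} {n : nat}.
Variable delta : 'rV[R]_n.
Hypothesis delta_inj : injective (delta 0).
Let D := diag_mx delta.
Hypothesis D_sl : sl D.
Variable C : 'M[R]_n -> Prop.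
Hypothesis C_orbit : forall X, coad_orbit D X -> C X.
Hypothesis C_mid : forall X Y, C X -> C Y -> C (2^-1 *: (X + Y)).

(* The directions of the lines through [D] contained in [C]; by convexity they
   form a vector space. *)
Let L X := forall r, C (D + r *: X).

Let L_scale s X : L X -> L (s *: X).
Proof. by move=> LX r; rewrite scalerA. Qed.

Let L_add X Y : L X -> L Y -> L (X + Y).
Proof.
move=> LX LY r.
have -> : D + r *: (X + Y) =
    2^-1 *: ((D + (2 * r) *: X) + (D + (2 * r) *: Y)).
  by apply/matrixP => i j; rewrite !mxE; field.
exact: C_mid.
Qed.

Let orbit_line g i j r : SL g -> i != j ->
  C (g *m (D + r *: delta_mx i j) *m invmx g).
Proof.
move=> gSL ij; have dij : delta 0 j - delta 0 i != 0.
  by rewrite subr_eq0; apply: contra ij => /eqP/delta_inj ->.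
apply: C_orbit; pose U := transvection i j (r / (delta 0 j - delta 0 i)).
have USL : SL U by exact: det_transvection.
exists (g *m U); first exact: SL_mul.
rewrite (_ : invmx (g *m U) = invmx U *m invmx g); last first.
  have gu := SL_unit gSL; have Uu := SL_unit USL.
  have gU : g *m U \in unitmx by rewrite unitmx_mul gu.
  apply: (can_inj (mulKmx gU)); rewrite mulmxV// -mulmxA [U *m _]mulmxA.
  by rewrite mulmxV// mul1mx mulmxV.
rewrite -!mulmxA; congr (g *m _); rewrite !mulmxA; congr (_ *m invmx g).
by rewrite transvection_conj_diag// divfK.
Qed.

Let L0 : L 0.
Proof.
by move=> r; rewrite scaler0 addr0; apply: C_orbit; exact: coad_orbit_refl.
Qed.

Let L_delta i j : i != j -> L (delta_mx i j).
Proof.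
by move=> ij r; have := orbit_line r SL1 ij; rewrite invmx1 mulmx1 mul1mx.
Qed.

(* A diagonal direction comes from the conjugate of [E_ji] by [1 + E_ij], which
   is [E_ji + E_ii - E_jj - E_ij]. *)
Let L_diag i j : L (delta_mx i i - delta_mx j j).
Proof.
have [->|ij] := eqVneq i j; first by rewrite subrr.
have ji : j != i by rewrite eq_sym.
suff LN : L (delta_mx j i + (delta_mx i i - delta_mx j j) - delta_mx i j).
  have -> : delta_mx i i - delta_mx j j =
      (delta_mx j i + (delta_mx i i - delta_mx j j) - delta_mx i j) +
      ((-1) *: delta_mx j i + delta_mx i j) :> 'M[R]_n.
    by apply/matrixP => k l; rewrite !mxE; ring.
  apply: L_add => //; apply: L_add; [apply: L_scale|]; exact: L_delta.
move=> r; pose U : 'M[R]_n := transvection i j 1.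
have USL : SL U by exact: det_transvection.
(* The first conjugate compensates for the fact that [U] moves [D]. *)
have -> : D + r *: (delta_mx j i + (delta_mx i i - delta_mx j j) - delta_mx i j)
    = 2^-1 *:
      (U *m (D + (- 2 * (delta 0 j - delta 0 i)) *: delta_mx i j) *m invmx U +
       U *m (D + (2 * r) *: delta_mx j i) *m invmx U).
  have conjD s X : U *m (D + s *: X) *m invmx U =
      U *m D *m invmx U + s *: (U *m X *m invmx U).
    by rewrite mulmxDr mulmxDl -scalemxAr -scalemxAl.
  rewrite !conjD transvection_conj_diag//.
  rewrite transvection_conj_delta// transvection_conj_deltaC//.
  by apply/matrixP => k l; rewrite !mxE; field.
by apply: C_mid; exact: orbit_line.
Qed.

Let L_sl X : sl X -> L X.
Proof.
move=> Xsl; case: (pickP (fun _ : 'I_n => true)) => [l0 _|no]; last first.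
  suff -> : X = 0 by exact: L0.
  by apply/matrixP => i; have := no i.
have -> : X = \sum_l \sum_k
    X l k *: (delta_mx l k - (l == k)%:R *: delta_mx l0 l0).
  transitivity (\sum_l
      (\sum_k X l k *: delta_mx l k - X l l *: delta_mx l0 l0) : 'M[R]_n).
    rewrite sumrB -scaler_suml (_ : \sum_i X i i = 0) ?scale0r ?subr0//.
    exact: matrix_sum_delta.
  apply: eq_bigr => l _; under [RHS]eq_bigr do rewrite scalerBr.
  rewrite sumrB; congr (_ - _).
  rewrite (bigD1 l)//= eqxx scale1r big1 ?addr0// => k kl.
  by rewrite eq_sym (negPf kl) scale0r scaler0.
elim/big_ind: _ => [||l _]; [exact: L0|exact: L_add|].
elim/big_ind: _ => [||k _]; [exact: L0|exact: L_add|apply: L_scale].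
have [->|lk] := eqVneq l k; first by rewrite scale1r; exact: L_diag.
by rewrite scale0r subr0; exact: L_delta.
Qed.

Lemma midpoint_hull_orbit X : sl X -> C X.
Proof.
move=> Xsl; have -> : X = D + 1 *: (X - D) by rewrite scale1r addrC subrK.
by apply: L_sl; rewrite /sl /= linearB /= Xsl D_sl subrr.
Qed.

End MidpointHull.

Lemma convex_hull_orbit (R : realType) (n m : nat) (delta : 'rV[R]_n)
    (phi : 'M[R]_n -> 'rV[R]_m) (v : 'rV[R]_m) :
  injective (delta 0) -> sl (diag_mx delta) ->
  (forall X, coad_orbit (diag_mx delta) X -> phi X = v) ->
  closed_convex_hull ((fun X => (X, phi X)) @` coad_orbit (diag_mx delta)) =
  closure ([set p | sl p.1 /\ p.2 = v] : set ('M[R]_n * 'rV[R]_m)%type).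
Proof.
move=> delta_inj D_sl phi_v.
rewrite /closed_convex_hull; congr closure; apply/seteqP; split.
  apply: smallest_sub => [[X x] [Y y] k|_ [X XD <-] /=].
    rewrite !inE /= => -[Xsl ->] [Ysl ->]; split.
      by apply: sl_add; exact: sl_scale.
    by rewrite /= -scalerDl addrC subrK scale1r.
  by split; [exact: sl_orbit XD|exact: phi_v].
move=> [X x] /= [Xsl ->] K [Kconv KD].
apply: (@midpoint_hull_orbit _ _ delta delta_inj D_sl (fun X => K (X, v))) => //.
  by move=> Y YD; apply: KD; exists Y => //; rewrite phi_v.
move=> Y Z KY KZ.
have h0 : 0 <= 2^-1 :> R by rewrite invr_ge0 ler0n.
have h1 : 2^-1 <= 1 :> R by rewrite invf_le1 ?ltr0n// ler1n.
have := Kconv (Y, v) (Z, v) (Itv01 h0 h1).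
rewrite !inE => /(_ KY KZ); congr K => /=; congr pair.
  rewrite scalerDr; congr (_ + _ *: _).
  by change (1 - 2^-1 = 2^-1 :> R); field.
by rewrite -scalerDl addrC subrK scale1r.
Qed.

(** * Invariance under the orbit condition *)

Section Invariance.
Context {R : realType} {n m : nat}.
Variables (pi : 'M[R]_n -> 'M[R]_m) (phi : 'M[R]_n -> 'rV[R]_m).
Hypothesis rep : representation pi.
Hypothesis phi2 : polynomial_map_le 2 phi.
Hypothesis orbit_eq : forall xi, sl xi ->
  (fun xi => (xi, phi xi)) @` coad_orbit xi = coad_plus_orbit pi (xi, phi xi).

Lemma orbit_condition_rigidity (delta : 'rV[R]_n) i j :
  sl (diag_mx delta) -> i != j -> delta 0 i != delta 0 j ->
  (forall z, phi (diag_mx delta + z *: delta_mx i j) = phi (diag_mx delta)) /\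
  phi (diag_mx (swap_diag i j delta)) = phi (diag_mx delta).
Proof.
move=> Dsl; have [d [e te]] := taylor2_polynomial_map phi2.
have equiv := phi_equivariant rep orbit_eq.
have trans := phi_translation rep orbit_eq.
exact: (diagonal_rigidity rep equiv trans te Dsl).
Qed.

(** Transvections move [D] along the lines on which [phi] is constant, so by
    equivariance they fix [phi D]. *)
Lemma constant_on_orbit (delta : 'rV[R]_n) :
  sl (diag_mx delta) -> injective (delta 0) ->
  forall X, coad_orbit (diag_mx delta) X -> phi X = phi (diag_mx delta).
Proof.
move=> Dsl dinj _ [g gSL <-]; set D := diag_mx delta.
have equiv := phi_equivariant rep orbit_eq.
have [pi1 piM _] := rep.
suff [_ fixg] : SL g /\ phi D *m pi g = phi D.
  by apply: (representation_inj rep gSL); rewrite equiv// fixg.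
apply: (@SL_transvection_ind _ _ (fun g => SL g /\ phi D *m pi g = phi D)) => //.
  by split; [exact: SL1|rewrite pi1 mulmx1].
move=> i j r A ij [ASL fA]; pose U := transvection i j r.
have USL : SL U by exact: det_transvection.
split; first exact: SL_mul.
have dij : delta 0 i != delta 0 j by apply: contra ij => /eqP/dinj ->.
have UD : phi (U *m D *m invmx U) = phi D.
  rewrite transvection_conj_diag//.
  by case: (orbit_condition_rigidity Dsl ij dij).
by rewrite piM// mulmxA -[in LHS]UD equiv.
Qed.

End Invariance.

(** * A family of diagonal matrices with distinct spectra *)

Section Family.
Context {R : realType} {n : nat}.
Variable hn : (2 < n)%N.

Let i0 : 'I_n := Ordinal (ltnW (ltnW hn)).
Let i1 : 'I_n := Ordinal (ltnW hn).
Let i2 : 'I_n := Ordinal hn.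

Let c : R := - (\sum_(k < n | (2 < k)%N) (k + 10)%:R) / 3.

(** The first three entries are perturbations of [c], where [c <= 0] makes the
    trace vanish; the others are pairwise distinct and at least 13, hence larger
    than [c + 1]. *)
Definition spectrum (x y : R) : 'rV[R]_n :=
  \row_k (if k == i0 then c + x else if k == i1 then c + y
          else if k == i2 then c - x - y else (k + 10)%:R).

Let i10 : (i1 == i0) = false. Proof. by []. Qed.
Let i20 : (i2 == i0) = false. Proof. by []. Qed.
Let i21 : (i2 == i1) = false. Proof. by []. Qed.

Lemma spectrum_sl x y : sl (diag_mx (spectrum x y)).
Proof.
rewrite /sl /= mxtrace_diag (bigD1 i0)//= (bigD1 i1)//= (bigD1 i2)//=.
rewrite !mxE !eqxx i10 i20 i21.
rewrite (eq_bigl (fun k : 'I_n => (2 < k)%N)); last first.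
  by move=> k; rewrite -!val_eqE /=; case: (val k) => [|[|[|]]].
rewrite (eq_bigr (fun k : 'I_n => (k + 10)%:R)); last first.
  move=> k k2; rewrite mxE -!val_eqE /=.
  by case: (val k) k2 => [|[|[|]]].
by rewrite /c; field.
Qed.

Lemma swap_spectrum01 x y : swap_diag i0 i1 (spectrum x y) = spectrum y x.
Proof.
apply/rowP => k; rewrite !mxE !eqxx i10.
case: (k == i0) => //; case: (k == i1) => //.
by case: ifP => _ //; ring.
Qed.

Lemma swap_spectrum12 x y :
  swap_diag i1 i2 (spectrum x y) = spectrum x (- x - y).
Proof.
apply/rowP => k; rewrite !mxE !eqxx i10 i20 i21.
have [->//|_] := eqVneq k i0.
case: (k == i1); first by ring.
by case: (k == i2) => //; ring.
Qed.

Let c_le0 : c <= 0.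
Proof. by rewrite /c mulNr oppr_le0 divr_ge0 ?ler0n// sumr_ge0. Qed.

Lemma spectrum_inj x y : 2^-1 <= x < 1 -> 0 < y < 2^-1 ->
  injective (spectrum x y 0).
Proof.
move=> /andP[x0 x1] /andP[y0 y1] k l; rewrite !mxE; have c0 := c_le0.
have k0 : 0 <= k%:R :> R by [].
have l0 : 0 <= l%:R :> R by [].
have [->|_] := eqVneq k i0.
  have [->//|_] := eqVneq l i0.
  case: (l == i1) => [h|]; [exfalso; lra|].
  by case: (l == i2) => [|]; rewrite ?natrD => h; exfalso; lra.
have [->|_] := eqVneq k i1.
  case: (l == i0) => [h|]; [exfalso; lra|].
  have [->//|_] := eqVneq l i1.
  by case: (l == i2) => [|]; rewrite ?natrD => h; exfalso; lra.
have [->|_] := eqVneq k i2.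
  case: (l == i0) => [h|]; [exfalso; lra|].
  case: (l == i1) => [h|]; [exfalso; lra|].
  by have [->//|_] := eqVneq l i2; rewrite natrD => h; exfalso; lra.
case: (l == i0) => [|]; first by rewrite natrD => h; exfalso; lra.
case: (l == i1) => [|]; first by rewrite natrD => h; exfalso; lra.
case: (l == i2) => [|]; first by rewrite natrD => h; exfalso; lra.
by move/eqP; rewrite eqr_nat eqn_add2r => /eqP/val_inj.
Qed.

Lemma spectrum_generic x y :
  injective (spectrum x y 0) -> generic (diag_mx (spectrum x y)).
Proof.
move=> inj; split; first exact: spectrum_sl.
exists [seq real_complex R (spectrum x y 0 k) | k <- enum 'I_n]; split.
- by rewrite map_inj_uniq ?enum_uniq// => k l /= [] /inj.
- by rewrite size_map size_enum_ord.
move=> z /mapP[k _ ->]; apply/eigenvalueP; exists (delta_mx 0 k).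
  rewrite map_diag_mx; apply/rowP => l; rewrite mul_mx_diag !mxE eqxx /=.
  by have [->|] := eqVneq l k; rewrite /= ?mul1r ?mulr1 ?mul0r ?mulr0.
by apply/eqP => /matrixP/(_ 0 k)/eqP; rewrite !mxE !eqxx oner_eq0.
Qed.

(** Conjugate matrices have the same eigenvalues, and [c + x] is the only
    eigenvalue in the interval from [c + 1/2] to [c + 1]. *)
Lemma spectrum_separated x y x' y' :
  2^-1 <= x < 1 -> y' < 2^-1 -> - x' - y' < 0 ->
  coad_orbit (diag_mx (spectrum x y)) = coad_orbit (diag_mx (spectrum x' y')) ->
  x = x'.
Proof.
move=> /andP[x12 x1] y12 z0 Oeq.
have := coad_orbit_refl (diag_mx (spectrum x y)); rewrite Oeq => -[g gSL gE].
have : \det (diag_mx (spectrum x y) - (c + x)%:M) = 0.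
  rewrite -diag_const_mx -raddfB /= det_diag (bigD1 i0)//= !mxE eqxx.
  by rewrite subrr mul0r.
rewrite -gE.
have -> : g *m diag_mx (spectrum x' y') *m invmx g - (c + x)%:M =
    g *m (diag_mx (spectrum x' y') - (c + x)%:M) *m invmx g.
  by rewrite mulmxBr mulmxBl scalar_mxC mulmxK ?SL_unit.
rewrite !det_mulmx det_inv gSL invr1 mul1r mulr1.
rewrite -diag_const_mx -raddfB /= det_diag => /eqP/prodf_eq0[k _].
rewrite !mxE; have c0 := c_le0.
do 3?[case: ifP => _; first by move/eqP; lra].
by rewrite natrD; have : 0 <= k%:R :> R by []; move=> ? /eqP; lra.
Qed.

End Family.

(** ** Rational points of the conic *)

Section RationalPoints.
Context {R : realType}.
Implicit Types k l : nat.

(** The points [((N^2 - 1) / q, (2 N + 1) / q)] with [q = N^2 + N + 1] of the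
    conic [x^2 + x y + y^2 = 1]; starting at [N = 5] keeps the three numbers
    [x], [y], [- x - y] well apart. *)
Definition conic_x k : R :=
  ((k + 5)%:R ^+ 2 - 1) / ((k + 5)%:R ^+ 2 + (k + 5)%:R + 1).
Definition conic_y k : R :=
  (2 * (k + 5)%:R + 1) / ((k + 5)%:R ^+ 2 + (k + 5)%:R + 1).

Let ge5 k : 5 <= (k + 5)%:R :> R.
Proof. by rewrite ler_nat leq_addl. Qed.

Lemma conicE k : conic_x k ^+ 2 + conic_x k * conic_y k + conic_y k ^+ 2 = 1.
Proof.
rewrite /conic_x /conic_y; have := ge5 k; move: (k + 5)%:R => N N5.
by field; rewrite gt_eqF//; nra.
Qed.

Lemma conic_x_bounds k : 2^-1 <= conic_x k < 1.
Proof.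
rewrite /conic_x; have := ge5 k; move: (k + 5)%:R => N N5.
have q0 : 0 < N ^+ 2 + N + 1 by nra.
rewrite ler_pdivlMr// ltr_pdivrMr// mul1r.
by apply/andP; split; nra.
Qed.

Lemma conic_y_bounds k : 0 < conic_y k < 2^-1.
Proof.
rewrite /conic_y; have := ge5 k; move: (k + 5)%:R => N N5.
have q0 : 0 < N ^+ 2 + N + 1 by nra.
rewrite ltr_pdivlMr// ltr_pdivrMr// mul0r.
by apply/andP; split; nra.
Qed.

Lemma conic_x_inj : injective conic_x.
Proof.
move=> k l; rewrite /conic_x => E.
apply/eqP; rewrite -(eqn_add2r 5) -(eqr_nat R); apply/eqP.
have := ge5 k; have := ge5 l; move: E.
move: (k + 5)%:R (l + 5)%:R => N M E M5 N5.
have qN : 0 < N ^+ 2 + N + 1 by nra.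
have qM : 0 < M ^+ 2 + M + 1 by nra.
have : (N - M) * (N * M + 2 * N + 2 * M + 1) = 0.
  move/eqP: E; rewrite eqr_div ?(gt_eqF qN) ?(gt_eqF qM)// => /eqP E.
  by rewrite -[RHS](subrr ((N ^+ 2 - 1) * (M ^+ 2 + M + 1))) {2}E; ring.
move/eqP; rewrite mulf_eq0 subr_eq0 => /orP[/eqP//|].
by rewrite gt_eqF//; nra.
Qed.

End RationalPoints.

(** ** The value of the map on the family *)

(** On the plane of all [spectrum x y] the map is a polynomial of degree at most
    2 that is symmetric in [x], [y] and [- x - y], hence an affine function of
    [x^2 + x y + y^2]. *)
Lemma value_on_conic (R : realType) (n m : nat) (hn : (2 < n)%N)
    (pi : 'M[R]_n -> 'M[R]_m) (phi : 'M[R]_n -> 'rV[R]_m) :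
  representation pi -> polynomial_map_le 2 phi ->
  (forall xi, sl xi -> (fun xi => (xi, phi xi)) @` coad_orbit xi =
     coad_plus_orbit pi (xi, phi xi)) ->
  exists v : 'rV[R]_m, forall x y, x ^+ 2 + x * y + y ^+ 2 = 1 ->
    phi (diag_mx (spectrum hn x y)) = v.
Proof.
move=> rep phi2 orbit_eq.
pose i0 : 'I_n := Ordinal (ltnW (ltnW hn)).
pose i1 : 'I_n := Ordinal (ltnW hn).
pose i2 : 'I_n := Ordinal hn.
pose psi x y := phi (diag_mx (spectrum hn x y)).
have rigid i j x y :=
  orbit_condition_rigidity (i := i) (j := j) rep phi2 orbit_eq
    (spectrum_sl hn x y).
have psi01 x y : psi x y = psi y x.
  have [->//|xy] := eqVneq x y.
  have [] := rigid i0 i1 x y => //; last by rewrite swap_spectrum01.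
  by rewrite !mxE /=; apply: contra xy => /eqP/addrI/eqP.
have psi12 x y : psi x y = psi x (- x - y).
  have [<-//|xy] := eqVneq y (- x - y).
  have [] := rigid i1 i2 x y => //; last by rewrite swap_spectrum12.
  by rewrite !mxE /= -addrA; apply: contra xy => /eqP/addrI/eqP.
have [d [e te]] := taylor2_polynomial_map phi2.
pose D0 : 'M[R]_n := diag_mx (spectrum hn 0 0).
pose H1 : 'M[R]_n := diag_mx (spectrum hn 1 0) - D0.
pose H2 : 'M[R]_n := diag_mx (spectrum hn 0 1) - D0.
have psiE x y : psi x y = phi D0 + (x *: d D0 H1 + y *: d D0 H2) +
    (x ^+ 2 *: e H1 H1 + (x * y) *: (e H1 H2 + e H2 H1) + y ^+ 2 *: e H2 H2).
  have D0sl : sl D0 := spectrum_sl hn 0 0.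
  have Hsl x' y' : sl (diag_mx (spectrum hn x' y') - D0).
    by rewrite /sl /= linearB /= D0sl spectrum_sl subrr.
  rewrite -(taylor2_plane te)//; last by apply: sl_add; apply: sl_scale; exact: Hsl.
  congr phi; apply/matrixP => k l; rewrite !mxE.
  case: (k == l); rewrite ?mulr1n ?mulr0n; last by ring.
  by do 3?[case: (_ == _); first by ring]; ring.
exists (phi D0 + e H1 H1) => x y xy1; rewrite -/(psi x y) psiE.
(* These instances of the symmetries determine all coefficients but two. *)
have := (psi01 1 0, psi01 2 0, psi12 1 0, psi12 2 0, psi12 0 1, psi12 1 1).
rewrite !psiE.
move: (phi D0) (d D0 H1) (d D0 H2) (e H1 H1) (e H1 H2 + e H2 H1) (e H2 H2).
move=> c0 c1 c2 c11 c12 c22 [[[[[q1 q2] q3] q4] q5] q6]; apply/rowP => k.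
move: q1 q2 q3 q4 q5 q6 => /rowP/(_ k) q1 /rowP/(_ k) q2 /rowP/(_ k) q3.
move=> /rowP/(_ k) q4 /rowP/(_ k) q5 /rowP/(_ k) q6.
move: q1 q2 q3 q4 q5 q6; rewrite !mxE.
move: (c0 0 k) (c1 0 k) (c2 0 k) (c11 0 k) (c12 0 k) (c22 0 k).
move=> a0 a1 a2 a11 a12 a22 q1 q2 q3 q4 q5 q6.
have z1 : a1 = 0 by lra.
have z2 : a2 = 0 by lra.
have z3 : a12 = a11 by lra.
have z4 : a22 = a11 by lra.
by rewrite z1 z2 z3 z4 -[X in _ = _ + X]mul1r -xy1; ring.
Qed.

(** * The theorem *)

Theorem theorem5p4 (R : realType) (n : nat) (hn : (2 < n)%N) :
  ~ exists (m : nat) (pi : 'M[R]_n -> 'M[R]_m) (phi : 'M[R]_n -> 'rV[R]_m),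
      overalgebra_almost_separating 2 pi phi.
Proof.
case=> m [pi [phi [rep [phi2 _] orbit_eq fin]]].
have [v phiv] := value_on_conic hn rep phi2 orbit_eq.
pose delta k : 'rV[R]_n := spectrum hn (conic_x k) (conic_y k).
pose D k : 'M[R]_n := diag_mx (delta k).
have inj k : injective (delta k 0).
  by apply: spectrum_inj; [exact: conic_x_bounds|exact: conic_y_bounds].
have Dsl k : sl (D k) by exact: spectrum_sl.
have hull k : closed_convex_hull ((fun X => (X, phi X)) @` coad_orbit (D k)) =
    closure ([set p | sl p.1 /\ p.2 = v] : set ('M[R]_n * 'rV[R]_m)%type).
  apply: (convex_hull_orbit (inj k) (Dsl k)) => X XD.
  rewrite -(phiv _ _ (conicE k)).
  exact: (constant_on_orbit rep phi2 orbit_eq (Dsl k) (inj k)).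
have gen0 : generic (D 0) := spectrum_generic (inj 0).
have finD := finite_preimage (f := fun k => coad_orbit (D k)) _ (fin _ gen0).
apply: infinite_nat; apply: sub_finite_set (finD _).
  by move=> k _ /=; exists (D k); rewrite ?hull.
move=> k l _ _ E; apply: (@conic_x_inj R).
have /andP[y0 y1] := conic_y_bounds (R := R) l.
have /andP[x0 x1] := conic_x_bounds (R := R) l.
by apply: spectrum_separated E => //; [exact: conic_x_bounds|lra].
Qed.
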